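(* Let $n\ge 1$. For every $\varepsilon$ with $0\le\varepsilon\le 1$ and every Gram matrix $M$ (indexed by $\{0,1\}^n$), the coherent quantum query complexity of generating $M$ with error $\varepsilon$ satisfies $$Q_\varepsilon(M)\ \ge\ \mathrm{xpoly}_\varepsilon(M).$$
   Context: All matrices are complex matrices with rows and columns indexed by $\{0,1\}^n$; $\circ$ is the entrywise (Hadamard) product, $\mathbb I$ the identity, and $A\succeq 0$ means Hermitian positive semidefinite. A Gram matrix (always normalized) is a matrix $A\succeq 0$ with $A\circ\mathbb I=\mathbb I$ (all diagonal entries equal to 1). Fidelity: for density matrices $\rho,\sigma$ (positive semidefinite, trace 1), $\mathcal F(\rho,\sigma)=\mathrm{tr}\sqrt{\sqrt\rho\,\sigma\sqrt\rho}$. Hadamard product fidelity: for Gram matrices $A,B$, $\mathcal F_H(A,B)=\min_{u:\|u\|=1}\mathcal F(A\circ|u\rangle\langle u|,\,B\circ|u\rangle\langle u|)$, the minimum being over unit vectors $u\in\mathbb C^{\{0,1\}^n}$. Fourier basis: subsets $S\subseteq\{1,\dots,n\}$ are identified with their characteristic vectors in $\{0,1\}^n$, $|S|$ is the cardinality, and $|\chi_S\rangle=\frac1{\sqrt{2^n}}\sum_x(-1)^{S\cdot x}|x\rangle$. Extended polynomial bounds: for a Gram matrix $M$ and $0\le\varepsilon\le1$, $\mathrm{xpoly}_0(M)=\max_S\{|S|:\langle\chi_S|M|\chi_S\rangle\neq0\}$ and $\mathrm{xpoly}_\varepsilon(M)=\min_N\{\mathrm{xpoly}_0(N):\mathcal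 F_H(N,M)\ge\sqrt{1-\varepsilon},\ N\succeq0,\ N\circ\mathbb I=\mathbb I\}$. Query model and $Q_\varepsilon$: for $x\in\{0,1\}^n$, the oracle is the unitary $O_x:|i,b\rangle\mapsto(-1)^{b\cdot x_i}|i,b\rangle$, $i\in\{1,\dots,n\}$, $b\in\{0,1\}$. A $T$-query algorithm acts on a finite-dimensional space containing the query registers $|i,b\rangle$ and an arbitrary workspace; it starts in a fixed state independent of $x$ and applies $U_T O_x U_{T-1}O_x\cdots U_1O_xU_0$, where the $U_j$ are unitaries independent of $x$ and $O_x$ acts as the identity on the workspace. Given a Gram matrix $M$, choose unit vectors $|m_x\rangle$ in a Hilbert space $\mathcal H$ with $M=\sum_{x,x'}\langle m_{x'}|m_x\rangle|x\rangle\langle x'|$ (the choice does not matter). The coherent query complexity $Q_\varepsilon(M)$ is the minimum $T$ such that some $T$-query algorithm, whose total space is identified with $\mathcal H\otimes\mathcal H'$ for some $\mathcal H'$ with a fixed default unit vector $|\bar0\rangle\in\mathcal H'$, produces on every input $x\in\{0,1\}^n$ a final state $|n_x\rangle\in\mathcal H\otimes\mathcal H'$ with $\mathrm{Re}\big(\langle n_x|(|m_x\rangle\otimes|\bar0\rangle)\big)\ge\sqrt{1-\varepsilon}$. *)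

(* Defs.v *)
From HB Require Import structures.
From mathcomp Require Import all_boot all_order all_algebra.
From mathcomp Require Import all_classical.
From mathcomp Require Import reals constructive_ereal ereal.
From mathcomp Require Import sesquilinear spectral complex mxtens.

Set Implicit Arguments.
Unset Strict Implicit.
Unset Printing Implicit Defensive.

Import Order.TTheory GRing.Theory Num.Theory.
Local Open Scope ring_scope.
Local Open Scope classical_set_scope.
Local Open Scope sesquilinear_scope.

(* [M ^t*] is the conjugate transpose and [A *t B] the Kronecker product. *)

(* Minimum of a set of naturals; the minimum of the empty set is +oo. *)
Definition min_nat (R : realType) (P : set nat) : \bar R :=
  ereal_inf [set (k%:R)%:E | k in P].

Lemma min_natE (R : realType) (P : set nat) (k : nat) :
  P k -> (forall j, P j -> (k <= j)%N) -> min_nat R P = (k%:R)%:E.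
Proof.
move=> Pk kP; apply/eqP; rewrite eq_le; apply/andP; split.
  by apply: ereal_inf_lbound; exists k.
by apply: le_ereal_inf_tmp => _ [j Pj <-]; rewrite lee_fin ler_nat kP.
Qed.

Section LinearAlgebra.
Context {C : numClosedFieldType}.

(* Conjugate-linear in the first argument. *)
Definition braket d (u v : 'cV[C]_d) : C := (u^t* *m v) 0 0.

Definition unit_vector d (u : 'cV[C]_d) : Prop := braket u u = 1.

(* Over [C], [0 <= z] says that [z] is a nonnegative real number. *)
Definition psd d (A : 'M[C]_d) : Prop :=
  A \is hermsymmx /\ forall u : 'cV[C]_d, 0 <= braket u (A *m u).

Definition hadamard d (A B : 'M[C]_d) : 'M[C]_d := map2_mx *%R A B.

Definition gram d (A : 'M[C]_d) : Prop := psd A /\ hadamard A 1%:M = 1%:M.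

(* Positive square root, by spectral calculus; meant for [psd] arguments. *)
Definition mxsqrt d (A : 'M[C]_d) : 'M[C]_d :=
  (spectralmx A)^t* *m diag_mx (map_mx sqrtC (spectral_diag A))
    *m spectralmx A.

Lemma trmxC_mul m n p (A : 'M[C]_(m, n)) (B : 'M[C]_(n, p)) :
  (A *m B)^t* = B^t* *m A^t*.
Proof. by rewrite trmx_mul map_mxM. Qed.

Lemma mxsqrtP d (A : 'M[C]_d) :
  psd A -> psd (mxsqrt A) /\ mxsqrt A *m mxsqrt A = A.
Proof.
move=> [Ah A0].
have /orthomx_spectralP := hermitian_normalmx Ah.
rewrite (invmx_unitary (spectral_unitarymx A)) /mxsqrt.
have /unitarymxP := spectral_unitarymx A.
move: (spectralmx A) (spectral_diag A) => P D PP AE.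
have D0 i : 0 <= D 0 i.
  have := A0 (P^t* *m delta_mx i 0).
  have AP : A *m P^t* = P^t* *m diag_mx D.
    by rewrite AE -!mulmxA PP mulmx1.
  rewrite /braket trmxC_mul trmxCK [A *m _]mulmxA AP.
  rewrite !mulmxA -[_ *m P *m _]mulmxA PP mulmx1.
  by rewrite trmx_delta map_delta_mx -rowE -colE !mxE eqxx mulr1n.
have PK m (B : 'M[C]_(d, m)) : P *m (P^t* *m B) = B by rewrite mulmxA PP mul1mx.
have s0 i : 0 <= sqrtC (D 0 i) by rewrite sqrtC_ge0.
have Sh : (diag_mx (map_mx sqrtC D))^t* = diag_mx (map_mx sqrtC D).
  apply/matrixP => i j; rewrite !mxE eq_sym; case: eqP => [->|_].
    by rewrite !mulr1n; apply/CrealP/ger0_real.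
  by rewrite !mulr0n conjC0.
split; last first.
  rewrite -!mulmxA PK AE -!mulmxA; congr (_ *m _).
  rewrite mulmxA mulmx_diag; congr (diag_mx _ *m _); apply/rowP => i.
  by rewrite !mxE -expr2 sqrtCK.
split.
  apply/is_hermitianmxP; rewrite expr0 scale1r.
  by rewrite !trmxC_mul trmxCK Sh mulmxA.
move=> u; rewrite /braket -!mulmxA [u^t* *m _]mulmxA.
have -> : u^t* *m P^t* = (P *m u)^t* by rewrite trmxC_mul.
rewrite mxE sumr_ge0 // => i _; rewrite mul_diag_mx; move: (P *m u) => v.
by rewrite !mxE mulrCA mulr_ge0 // mulrC mul_conjC_ge0.
Qed.

End LinearAlgebra.

Section Fidelity.
Context {R : realType}.
Local Notation C := R[i].

Definition fidelity d (rho sigma : 'M[C]_d) : R :=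
  complex.Re (\tr (mxsqrt (mxsqrt rho *m sigma *m mxsqrt rho))).

(* For Gram matrices the infimum is a minimum: the fidelity is continuous in [u]
   and the unit sphere is compact. *)
Definition hadamard_fidelity d (A B : 'M[C]_d) : R :=
  inf [set fidelity (hadamard A (u *m u^t*)) (hadamard B (u *m u^t*))
      | u in [set u : 'cV[C]_d | unit_vector u]].

End Fidelity.

(* [{0,1}^n]; a matrix indexed by it is an ['M_#|cube n|], where the string
   [x] has index [enum_rank x]. *)
Definition cube (n : nat) : finType := {ffun 'I_n -> bool}.

Section Polynomial.
Context {C : numClosedFieldType}.

Definition chi n (S : {set 'I_n}) : 'cV[C]_#|cube n| :=
  \col_k ((sqrtC (2 ^+ n))^-1
          * (-1) ^+ (\sum_(i in S) (enum_val k : cube n) i)%N).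

Definition xpoly0 n (M : 'M[C]_#|cube n|) : nat :=
  \max_(S : {set 'I_n} | braket (chi S) (M *m chi S) != 0) #|S|.

End Polynomial.

Definition xpoly (R : realType) n (eps : R) (M : 'M[R[i]]_#|cube n|) : \bar R :=
  min_nat R [set xpoly0 N | N in [set N : 'M[R[i]]_#|cube n|
    | Num.sqrt (1 - eps) <= hadamard_fidelity N M /\ gram N]].

Section QueryModel.
Context {C : numClosedFieldType}.

(* Basis state [|i, b>] of the query registers has index
   [mxtens_index (i, b)] in ['I_(n * 2)]. *)
Definition oracle n (x : cube n) : 'M[C]_(n * 2) :=
  diag_mx (\row_k let ib := mxtens_unindex k in (-1) ^+ (ib.2 * x ib.1)%N).

(* [qa_unitary j] is [U_j]; only [U_0, ..., U_T] are used and constrained. *)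
Record query_algorithm (n T : nat) := QueryAlgorithm {
  qa_work : nat;
  qa_start : 'cV[C]_(n * 2 * qa_work);
  qa_unitary : nat -> 'M[C]_(n * 2 * qa_work);
  qa_startP : unit_vector qa_start;
  qa_unitaryP : forall j, (j <= T)%N -> qa_unitary j \is unitarymx }.

Fixpoint qa_state n T (a : query_algorithm n T) (x : cube n) (t : nat)
    : 'cV[C]_(n * 2 * qa_work a) :=
  if t is t'.+1 then
    qa_unitary a t *m ((oracle x *t (1%:M : 'M_(qa_work a))) *m qa_state a x t')
  else qa_unitary a 0 *m qa_start a.

Definition qa_final n T (a : query_algorithm n T) (x : cube n) :=
  qa_state a x T.

Definition gram_realization n d (M : 'M[C]_#|cube n|)
    (m : cube n -> 'cV[C]_d) : Prop :=
  (forall x, unit_vector (m x)) /\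
  forall x x', M (enum_rank x) (enum_rank x') = braket (m x') (m x).

End QueryModel.

Section Coherent.
Context {R : realType}.
Local Notation C := R[i].

(* [J] is the unitary identification of the total space with [H (x) H'],
   where [H] and [H'] have dimensions [d] and [d'], and [zero] is the default
   unit vector of [H']. *)
Definition generates n T (a : query_algorithm (C := C) n T) (eps : R) d
    (m : cube n -> 'cV[C]_d) : Prop :=
  exists (d' : nat) (zero : 'cV[C]_d') (J : 'M[C]_(d * d', n * 2 * qa_work a)),
    [/\ unit_vector zero,
        J \is unitarymx,
        J^t* \is unitarymx
      & forall x : cube n,
          Num.sqrt (1 - eps) <=
            complex.Re (braket (J *m qa_final a x) (m x *t zero))].

(* The choice of the realization [m] of [M] is immaterial (two realizations
   differ by a partial isometry), so it is quantified existentially. *)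
Definition query_complexity n (eps : R) (M : 'M[C]_#|cube n|) : \bar R :=
  min_nat R [set T | exists (d : nat) (m : cube n -> 'cV[C]_d)
                            (a : query_algorithm (C := C) n T),
                       gram_realization M m /\ generates a eps m].

End Coherent.

(* Main.v *)
(* The final states of a [T]-query algorithm are vector-valued polynomials of
   degree at most [T] in the signs [(-1)^(x_i)], since one query multiplies each
   amplitude by at most one of these signs; so their Gram matrix [N] annihilates
   every character of weight above [T], and [xpoly0 N <= T]. The final and the
   target states, scaled by the entries of [u], are purifications of the
   Hadamard products of [N] and [M] with [u u^*]; by Uhlmann's inequality the
   average of their overlaps, which is at least [sqrt (1 - eps)], is a lower
   bound of the fidelity. *)
Require Import Defs.
From mathcomp Require Import all_boot all_order all_algebra.
From mathcomp Require Import reals ereal.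
From mathcomp Require Import sesquilinear spectral complex mxtens ring.

Set Implicit Arguments.
Unset Strict Implicit.
Unset Printing Implicit Defensive.

Import Order.TTheory GRing.Theory Num.Theory.
Local Open Scope ring_scope.
Local Open Scope sesquilinear_scope.

(** * Uhlmann's inequality, through the polar decomposition *)

Section Uhlmann.
Context {C : numClosedFieldType}.

Lemma braketE d (u v : 'cV[C]_d) :
  braket u v = \sum_k (u k 0)^* * v k 0.
Proof. by rewrite /braket mxE; apply: eq_bigr => k _; rewrite !mxE. Qed.

Lemma braket_ge0 d (u : 'cV[C]_d) : 0 <= braket u u.
Proof.
by rewrite braketE sumr_ge0 // => k _; rewrite mulrC mul_conjC_ge0.
Qed.

Lemma braketC d (u v : 'cV[C]_d) : (braket u v)^* = braket v u.
Proof.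
rewrite !braketE rmorph_sum; apply: eq_bigr => k _.
by rewrite rmorphM /= conjCK mulrC.
Qed.

Lemma braket_col d p q (A : 'M[C]_(d, p)) (B : 'M[C]_(d, q)) i j :
  braket (col i A) (col j B) = (A^t* *m B) i j.
Proof. by rewrite braketE mxE; apply: eq_bigr => k _; rewrite !mxE. Qed.

Lemma mulmx_adj_eq0 m n (A : 'M[C]_(m, n)) i :
  (A *m A^t*) i i = 0 -> row i A = 0.
Proof.
rewrite mxE => /eqP; rewrite psumr_eq0 => [/allP A0|k _]; last first.
  by rewrite !mxE mul_conjC_ge0.
apply/rowP => k; rewrite !mxE; apply/eqP; rewrite -mul_conjC_eq0.
by have := A0 k; rewrite mem_index_enum !mxE => /(_ isT).
Qed.

(** Half of a singular value decomposition. In an eigenbasis of [Y *m Y^t*] the eigenvalues are the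
    squared norms of the rows of [V *m Y], hence nonnegative, and [s] collects their roots. *)
Lemma mxsqrt_mul_adj d k (Y : 'M[C]_(d, k)) :
  exists (V : 'M[C]_d) (s : 'rV[C]_d),
    [/\ V \is unitarymx, forall i, 0 <= s 0 i,
        mxsqrt (Y *m Y^t*) = V^t* *m diag_mx s *m V
      & (V *m Y) *m (V *m Y)^t* = diag_mx (map_mx (fun z => z ^+ 2) s)].
Proof.
have Yh : Y *m Y^t* \is hermsymmx.
  by apply/is_hermitianmxP; rewrite expr0 scale1r trmxC_mul trmxCK.
have := orthomx_spectralP (hermitian_normalmx Yh).
rewrite (invmx_unitary (spectral_unitarymx _)) /mxsqrt.
have := spectral_unitarymx (Y *m Y^t*).
move: (spectralmx _) (spectral_diag _) => V D Vu YE.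
have /unitarymxP VV := Vu.
have DE : (V *m Y) *m (V *m Y)^t* = diag_mx D.
  rewrite trmxC_mul -mulmxA [Y *m _]mulmxA YE -!mulmxA VV mulmx1.
  by rewrite mulmxA VV mul1mx.
have D0 i : 0 <= D 0 i.
  have := congr1 (fun A : 'M_d => A i i) DE.
  rewrite [RHS]mxE eqxx mulr1n => <-; move: (V *m Y) => Z.
  by rewrite mxE sumr_ge0 // => j _; rewrite !mxE mul_conjC_ge0.
exists V, (map_mx sqrtC D); split => // [i|]; first by rewrite mxE sqrtC_ge0.
by rewrite DE; congr diag_mx; apply/rowP => i; rewrite !mxE sqrtCK.
Qed.

(** Take for [W] the pseudoinverse of the square root times [Y]. Then [W *m W^t*] is an orthogonal
    projection, so [W^t*] is a contraction, which is all that the trace bound needs. *)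
Lemma polar_decomposition d k (Y : 'M[C]_(d, k)) :
  exists2 W : 'M[C]_(d, k), Y = mxsqrt (Y *m Y^t*) *m W &
    forall v, braket (W^t* *m v) (W^t* *m v) <= braket v v.
Proof.
have [V [s [Vu s0 -> YE]]] := mxsqrt_mul_adj Y.
have /unitarymxP VV := Vu.
have VV' : V^t* *m V = 1%:M by rewrite -invmx_unitary // mulVmx // unitarymx_unit.
(* Since [0^-1 = 0], this is the pseudoinverse of [mxsqrt (Y *m Y^t* )]. *)
pose t : 'rV[C]_d := map_mx (fun z => z^-1) s.
have tc : (diag_mx t)^t* = diag_mx t.
  apply/matrixP => i j; rewrite !mxE eq_sym; case: eqP => [->|_].
    by rewrite !mulr1n; apply/CrealP/ger0_real; rewrite invr_ge0.
  by rewrite !mulr0n conjC0.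
exists (V^t* *m diag_mx t *m (V *m Y)).
  have -> : V^t* *m diag_mx s *m V *m (V^t* *m diag_mx t *m (V *m Y)) =
            V^t* *m (diag_mx s *m (diag_mx t *m (V *m Y))).
    by rewrite -!mulmxA [V *m (V^t* *m _)]mulmxA VV mul1mx.
  rewrite -[LHS]mul1mx -VV' -mulmxA; congr (_ *m _).
  move: (V *m Y) YE => Z ZE; apply/row_matrixP => i.
  have ZE' := congr1 (fun A : 'M_d => A i i) ZE.
  (* Where [s] vanishes, row [i] of [V *m Y] has norm 0, so the pseudoinverse loses nothing. *)
  case: (eqVneq (s 0 i) 0) => [si0|si0].
    move: ZE'; rewrite [RHS]mxE eqxx mulr1n [RHS]mxE si0 expr0n /=.
    move=> /mulmx_adj_eq0 Zi; rewrite Zi.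
    by apply/rowP => j; rewrite !mul_diag_mx !mxE si0 mul0r.
  by apply/rowP => j; rewrite !mul_diag_mx !mxE mulVKf.
move=> v; rewrite /braket.
have -> : (v^t* *m v) = (V *m v)^t* *m (V *m v).
  by rewrite trmxC_mul -mulmxA [V^t* *m _]mulmxA VV' mul1mx.
rewrite [(_^t* *m v)^t*]trmxC_mul trmxCK.
have -> : v^t* *m (V^t* *m diag_mx t *m (V *m Y)) *m
    ((V^t* *m diag_mx t *m (V *m Y))^t* *m v) =
    (V *m v)^t* *m (diag_mx t *m ((V *m Y) *m (V *m Y)^t*) *m diag_mx t *m (V *m v)).
  rewrite [(V^t* *m diag_mx t *m (V *m Y))^t*]trmxC_mul.
  by rewrite [(V^t* *m diag_mx t)^t*]trmxC_mul tc trmxCK [(V *m v)^t*]trmxC_mul !mulmxA.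
(* The middle factor becomes diagonal with entries [t * s ^+ 2 * t], each 0 or 1. *)
rewrite YE; move: (V *m v) => w; rewrite -/(braket _ _) -/(braket w w) !braketE.
apply: ler_sum => i _; rewrite !mulmx_diag mul_diag_mx !mxE.
case: (eqVneq (s 0 i) 0) => [->|si0].
  by rewrite invr0 !mul0r mulr0 mulrC mul_conjC_ge0.
by rewrite expr2 mulKf // mulfV // mul1r.
Qed.

(** Cauchy-Schwarz, with [z + z^*] in place of twice the real part of [z], since [C] is an abstract
    closed field. The case [s = 0] is separate because the main argument cancels a factor [s]. *)
Lemma braket_le d (s : C) (u v : 'cV[C]_d) :
  0 <= s -> braket u u <= 1 -> braket v v = s ^+ 2 ->
  braket u v + (braket u v)^* <= s *+ 2.
Proof.
move=> s0 u1 vs; move: s0; rewrite le_eqVlt => /predU1P[s0|s0].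
  suff -> : v = 0 by rewrite /braket mulmx0 mxE conjC0 addr0 -s0 mul0rn.
  apply/colP => k; rewrite mxE; apply/eqP; rewrite -mul_conjC_eq0 mulrC.
  move: vs; rewrite -s0 expr0n braketE /= => /eqP.
  rewrite psumr_eq0 => [/allP v0|j _]; last by rewrite mulrC mul_conjC_ge0.
  by have := v0 k; rewrite mem_index_enum => /(_ isT).
have sr : s^* = s by apply/CrealP/ger0_real/ltW.
(* Cauchy-Schwarz: expand [0 <= |s u - v|^2]. *)
have : 0 <= braket (s *: u - v) (s *: u - v) by apply: braket_ge0.
have -> : braket (s *: u - v) (s *: u - v) =
    s ^+ 2 * braket u u - s * (braket u v + (braket u v)^*) + braket v v.
  rewrite !braketE rmorph_sum -big_split !mulr_sumr -sumrB -big_split /=.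
  apply: eq_bigr => k _; rewrite !mxE rmorphB !rmorphM /= sr conjCK; ring.
rewrite vs => h.
have : s * (braket u v + (braket u v)^*) <= s * (s *+ 2).
  rewrite -subr_ge0; apply: le_trans h _.
  rewrite addrAC lerD2r mulr2n mulrDr -expr2 lerD2r.
  by rewrite ler_piMr // exprn_ge0 // ltW.
by rewrite ler_pM2l.
Qed.

(** Compute the trace in an eigenbasis [v_i] of [X^t* *m X]: its terms are the overlaps of
    [W^t* *m v_i], of norm at most 1, with [X *m v_i], of norm [s_i]. The [s_i] sum to the trace
    norm of [X]. *)
Lemma contraction_trace_le d k (W : 'M[C]_(d, k)) (X : 'M[C]_(k, d)) :
  (forall v, braket (W^t* *m v) (W^t* *m v) <= braket v v) ->
  \tr (W *m X) + (\tr (W *m X))^* <= \tr (mxsqrt (X^t* *m X)) *+ 2.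
Proof.
move=> Wc; have [V [s [Vu s0]]] := mxsqrt_mul_adj (X^t*).
rewrite trmxCK => -> XE; have /unitarymxP VV := Vu.
have VV' : V^t* *m V = 1%:M by rewrite -invmx_unitary // mulVmx // unitarymx_unit.
have -> : \tr (V^t* *m diag_mx s *m V) = \sum_i s 0 i.
  by rewrite mxtrace_mulC mulmxA VV mul1mx mxtrace_diag.
have -> : \tr (W *m X) =
    \sum_i braket (W^t* *m col i (V^t*)) (X *m col i (V^t*)).
  rewrite -[W *m X]mul1mx -VV' -mulmxA mxtrace_mulC; apply: eq_bigr => i _.
  rewrite !colE !mulmxA -!colE braket_col trmxC_mul !trmxCK.
  by rewrite !mulmxA.
rewrite rmorph_sum -big_split -sumrMnl; apply: ler_sum => i _; apply: braket_le => //.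
  by apply: le_trans (Wc _) _; rewrite braket_col trmxCK VV mxE eqxx.
rewrite colE mulmxA -colE braket_col.
have -> : (X *m V^t*)^t* *m (X *m V^t*) = diag_mx (map_mx (fun z => z ^+ 2) s).
  by rewrite -XE !trmxC_mul !trmxCK !mulmxA.
by rewrite !mxE eqxx.
Qed.

(** With the polar decomposition [A = P *m W], the left trace is that of [W *m X] for
    [X = B^t* *m P], and [X^t* *m X] is the matrix under the outer square root. *)
Lemma uhlmann_le d k (A B : 'M[C]_(d, k)) :
  \tr (A *m B^t*) + (\tr (A *m B^t*))^* <=
  \tr (mxsqrt (mxsqrt (A *m A^t*) *m (B *m B^t*) *m mxsqrt (A *m A^t*))) *+ 2.
Proof.
have [W AE Wc] := polar_decomposition A.
have Ph : (mxsqrt (A *m A^t*))^t* = mxsqrt (A *m A^t*).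
  have [V [s [_ s0 -> _]]] := mxsqrt_mul_adj A.
  rewrite !trmxC_mul trmxCK mulmxA; congr (_ *m _ *m _).
  apply/matrixP => i j; rewrite !mxE eq_sym; case: eqP => [->|_].
    by rewrite !mulr1n; apply/CrealP/ger0_real.
  by rewrite !mulr0n conjC0.
move: (mxsqrt _) AE Ph => P -> Ph.
have -> : \tr (P *m W *m B^t*) = \tr (W *m (B^t* *m P)).
  by rewrite -mulmxA mxtrace_mulC mulmxA.
by have := contraction_trace_le (B^t* *m P) Wc; rewrite trmxC_mul trmxCK Ph !mulmxA.
Qed.

End Uhlmann.

(** * Fourier degree of the states of a query algorithm *)

Section PolynomialMethod.
Context {C : numClosedFieldType}.

Definition parity n (S : {set 'I_n}) (x : cube n) : C :=
  (-1) ^+ (\sum_(i in S) x i)%N.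

Definition flip n (i : 'I_n) (x : cube n) : cube n :=
  [ffun j => (j == i) (+) x j].

Lemma flipK n (i : 'I_n) : involutive (flip i).
Proof. by move=> x; apply/ffunP => j; rewrite !ffunE addbA addbb. Qed.

Lemma parity_flip n (S : {set 'I_n}) i x :
  i \in S -> parity S (flip i x) = - parity S x.
Proof.
move=> iS; rewrite /parity !(bigD1 i iS) /= ffunE eqxx !exprD.
rewrite (eq_bigr (fun j => x j : nat)) => [|j /andP[_ /negPf ji]].
  by case: (x i); rewrite /= ?mulN1r ?mul1r ?opprK.
by rewrite ffunE ji.
Qed.

(** Flipping a bit of [S] permutes the cube and negates every term, so the sum is its own
    opposite. *)
Lemma sum_parity n (S : {set 'I_n}) : S != finset.set0 -> \sum_x parity S x = 0.
Proof.
move=> /set0Pn[i iS]; have : \sum_x parity S x = - \sum_x parity S x.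
  rewrite [LHS](reindex_inj (inv_inj (flipK i))) -sumrN.
  by apply: eq_bigr => x _; apply: parity_flip.
by move/eqP; rewrite -subr_eq0 opprK -mulr2n mulrn_eq0 => /eqP.
Qed.

(* [S'] is [S], or its symmetric difference with [{i}] if [b] holds. *)
Lemma parity_mul n (S : {set 'I_n}) i (b : bool) :
  exists2 S' : {set 'I_n}, (#|S| <= #|S'|.+1)%N &
    forall x, parity S x * (-1) ^+ (b * x i)%N = parity S' x.
Proof.
case: b; last by exists S => // x; rewrite mul0n expr0 mulr1.
have [iS|iS] := boolP (i \in S).
  exists (S :\ i) => [|x]; first by rewrite (cardsD1 i) iS.
  rewrite mul1n /parity (bigD1 i iS) /= exprD mulrAC -exprD addnn -mul2n exprM.
  rewrite sqrrN !expr1n mul1r; congr (_ ^+ _); apply: eq_bigl => j.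
  by rewrite !inE andbC.
exists (i |: S) => [|x]; first by rewrite cardsU1 iS ltnW.
by rewrite mul1n /parity big_setU1 //= exprD mulrC.
Qed.

(** Degree as a polynomial in the signs [(-1)^(x_i)], read off the Fourier side: the coefficients at
    sets of more than [t] elements vanish. *)
Definition degree_le n d t (f : cube n -> 'cV[C]_d) : Prop :=
  forall S : {set 'I_n}, (t < #|S|)%N -> \sum_x parity S x *: f x = 0.

Lemma degree_le_mulmx n d d' t (A : 'M[C]_(d', d)) (f : cube n -> 'cV[C]_d) :
  degree_le t f -> degree_le t (fun x => A *m f x).
Proof.
move=> ft S St; rewrite -[RHS](mulmx0 _ A) -(ft S St) mulmx_sumr.
by apply: eq_bigr => x _; rewrite scalemxAr.
Qed.

(** The oracle multiplies the amplitude at [(i, b)] by a parity of weight at most 1, which shifts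
    its coefficient at [S] to one at some [S'] smaller by at most one element. As [S'] depends on
    [(i, b)], the argument is made for each coordinate. *)
Lemma degree_le_oracle n w t (f : cube n -> 'cV[C]_(n * 2 * w)) :
  degree_le t f ->
  degree_le t.+1 (fun x => (oracle x *t (1%:M : 'M_w)) *m f x).
Proof.
move=> ft S St; apply/colP => k; rewrite summxE mxE.
case: (mxtens_indexP k) => q a; case: (mxtens_indexP q) => i b.
have b01 : b = (b != 0) :> nat by case: b => -[|[|]].
have [S' SS' SE] := parity_mul S i (b != 0).
have /colP/(_ (mxtens_index (mxtens_index (i, b), a))) :=
  ft S' (leq_trans St SS').
rewrite summxE mxE => fS; rewrite -[RHS]fS; apply: eq_bigr => x _.
rewrite !mxE -SE -mulrA; congr (_ * _).
rewrite (bigD1 (mxtens_index (mxtens_index (i, b), a))) //= big1 ?addr0.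
  rewrite tensmxE !mxE !eqxx !mulr1n mulr1 mxtens_indexK /=.
  by rewrite b01.
move=> l; case: (mxtens_indexP l) => q' a' ne.
rewrite tensmxE !mxE.
case: (eqVneq _ q') ne => [<-|]; last by rewrite mulr0n !mul0r.
case: (eqVneq a a') => [<-|]; first by rewrite eqxx.
by rewrite mulr0n mulr0 mul0r.
Qed.

Lemma degree_qa_state n T (a : query_algorithm (C := C) n T) t :
  degree_le t (fun x => qa_state a x t).
Proof.
elim: t => [|t IHt] /=; apply: degree_le_mulmx; last exact: degree_le_oracle.
(* Before any query the state does not depend on [x]. *)
move=> S; rewrite card_gt0 => S0.
by rewrite -scaler_suml sum_parity ?scale0r.
Qed.

Definition vectors_mx n d (f : cube n -> 'cV[C]_d) : 'M[C]_(#|cube n|, d) :=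
  \matrix_(i, k) f (enum_val i) k 0.

(** Up to normalization, and since [chi S] is real, [(chi S)^t* *m vectors_mx f] is the Fourier
    coefficient of [f] at [S]. *)
Lemma xpoly0_degree n d t (f : cube n -> 'cV[C]_d) :
  degree_le t f -> (xpoly0 (vectors_mx f *m (vectors_mx f)^t*) <= t)%N.
Proof.
move=> ft; apply/bigmax_leqP => S; apply: contraR; rewrite -ltnNge => St.
rewrite /braket -mulmxA mulmxA.
suff -> : (chi S)^t* *m vectors_mx f = 0 :> 'M[C]_(1, d) by rewrite mul0mx mxE.
apply/rowP => k; rewrite !mxE.
have /(congr1 (fun v : 'cV_d => v k 0)) := ft S St.
rewrite summxE mxE => fS.
rewrite -[RHS](mulr0 (sqrtC (2 ^+ n))^-1) -[in RHS]fS mulr_sumr.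
rewrite [RHS](reindex _ (onW_bij _ (@enum_val_bij (cube n)))) /=.
apply: eq_bigr => i _; rewrite !mxE mulrA; congr (_ * _).
rewrite rmorphM /= rmorphV ?unitfE ?sqrtC_eq0 ?expf_neq0 ?pnatr_eq0 //.
congr (_^-1 * _); last by rewrite rmorphXn rmorphN1.
by apply/CrealP/ger0_real; rewrite sqrtC_ge0 exprn_ge0.
Qed.

End PolynomialMethod.

(** * Gram matrices of families of vectors, and isometries *)

Section VectorsGram.
Context {C : numClosedFieldType}.

Lemma vectors_gramE n d (f : cube n -> 'cV[C]_d) i j :
  (vectors_mx f *m (vectors_mx f)^t*) i j =
  braket (f (enum_val j)) (f (enum_val i)).
Proof.
by rewrite mxE braketE; apply: eq_bigr => k _; rewrite !mxE mulrC.
Qed.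

Lemma gram_vectors n d (f : cube n -> 'cV[C]_d) :
  (forall x, unit_vector (f x)) -> gram (vectors_mx f *m (vectors_mx f)^t*).
Proof.
move=> f1; split; last first.
  apply/matrixP => i j; rewrite mxE vectors_gramE !mxE.
  by case: eqP => [->|]; rewrite ?mulr0 // mulr1 f1.
split; first by apply/is_hermitianmxP; rewrite expr0 scale1r trmxC_mul trmxCK.
move=> u; rewrite /braket -mulmxA mulmxA.
have := braket_ge0 ((vectors_mx f)^t* *m u).
by rewrite /braket trmxC_mul trmxCK.
Qed.

(** Scaling each vector by its entry of [u] keeps the form [A *m A^t*] to which [uhlmann_le]
    applies. *)
Lemma hadamard_vectors n d (f : cube n -> 'cV[C]_d) (u : 'cV[C]_#|cube n|) :
  hadamard (vectors_mx f *m (vectors_mx f)^t*) (u *m u^t*) =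
  (diag_mx u^T *m vectors_mx f) *m (diag_mx u^T *m vectors_mx f)^t*.
Proof.
apply/matrixP => i j; rewrite !mul_diag_mx [LHS]mxE !mxE big_ord1 mulr_suml.
by apply: eq_bigr => k _; rewrite !mxE rmorphM /=; ring.
Qed.

(** For a rectangular [U], being an isometry is [U^t* *m U = 1], that is, [unitarymx] of the
    adjoint. *)
Lemma braket_unitarymx d d' (U : 'M[C]_(d', d)) (v w : 'cV[C]_d) :
  U^t* \is unitarymx -> braket (U *m v) (U *m w) = braket v w.
Proof.
move=> /unitarymxP; rewrite trmxCK => UU.
by rewrite /braket trmxC_mul -mulmxA [U^t* *m _]mulmxA UU mul1mx.
Qed.

Lemma braket_tens d d' (u v : 'cV[C]_d) (z w : 'cV[C]_d') :
  braket (u *t z) (v *t w) = braket u v * braket z w.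
Proof.
rewrite !braketE mulr_sum; apply: eq_bigr => k _.
have tE (p : 'cV_d) (q : 'cV_d') : (p *t q) k 0 =
    p (mxtens_unindex k).1 0 * q (mxtens_unindex k).2 0.
  by rewrite mxE; congr (p _ _ * q _ _); apply: ord1.
by rewrite !tE rmorphM mulrACA.
Qed.

Lemma query_unitarymx n w (x : cube n) :
  (oracle x *t (1%:M : 'M[C]_w))^t* \is unitarymx.
Proof.
apply/unitarymxP; rewrite trmxCK trmx_tens map_mxT tensmx_mul.
rewrite trmx1 map_mx1 mulmx1.
have -> : (oracle x)^t* *m oracle x = 1%:M :> 'M[C]_(n * 2).
  rewrite tr_diag_mx map_diag_mx mulmx_diag -diag_const_mx.
  congr diag_mx; apply/rowP => k.
  by rewrite !mxE rmorphXn rmorphN1 -exprMn mulrNN mulr1 expr1n.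
apply/matrixP => k l; case: (mxtens_indexP k) => k1 k2.
case: (mxtens_indexP l) => l1 l2; rewrite tensmxE !mxE -natrM mulnb.
by rewrite (can_eq (@mxtens_indexK _ _)) xpair_eqE.
Qed.

Lemma unit_qa_state n T (a : query_algorithm (C := C) n T) x t :
  (t <= T)%N -> unit_vector (qa_state a x t).
Proof.
have U j v w : (j <= T)%N ->
    braket (qa_unitary a j *m v) (qa_unitary a j *m w) = braket v w.
  by move=> jT; apply: braket_unitarymx; rewrite trmxC_unitary qa_unitaryP.
elim: t => [|t IHt] tT; rewrite /unit_vector /= U //; first exact: qa_startP.
by rewrite (braket_unitarymx _ _ (query_unitarymx _ x)); apply/IHt/ltnW.
Qed.

End VectorsGram.

(** * From overlaps to fidelity, and the lower bound *)

Lemma complex_addC (R : rcfType) (z : R[i]) : z + z^* = (complex.Re z *+ 2)%:C%C.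
Proof. by case: z => a b; apply/eqP; rewrite eq_complex /= subrr !eqxx. Qed.

Lemma hadamard_fidelity_ge (R : realType) n d (f g : cube n -> 'cV[R[i]]_d)
    (c : R) :
  (forall x, c <= complex.Re (braket (f x) (g x))) ->
  c <= hadamard_fidelity (vectors_mx f *m (vectors_mx f)^t*)
                         (vectors_mx g *m (vectors_mx g)^t*).
Proof.
move=> fg; apply: lb_le_inf.
  (* A lower bound passes to the real [inf] only for a nonempty set; a basis vector is a witness. *)
  have x0 : 'I_#|cube n| := enum_rank ([ffun=> false] : cube n).
  eexists; exists (delta_mx x0 0); last by reflexivity.
  rewrite /= /unit_vector /braket trmx_delta map_delta_mx mul_delta_mx.
  by rewrite mxE !eqxx.
move=> _ [u /= u1 <-]; rewrite /fidelity !hadamard_vectors.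
set A := diag_mx _ *m vectors_mx f; set B := diag_mx _ *m vectors_mx g.
have := uhlmann_le A B; set Q := mxsqrt (_ *m mxsqrt _) => AB.
suff : (c *+ 2)%:C%C <= \tr Q *+ 2.
  case: (\tr Q) => a b; rewrite lecE [_ a b *+ 2]mulr2n => /andP[_ /=].
  by rewrite -mulr2n lerMn2r.
apply: le_trans AB.
have -> : \tr (A *m B^t*) =
    \sum_i (u i 0)^* * u i 0 * braket (g (enum_val i)) (f (enum_val i)).
  apply: eq_bigr => i _; rewrite /A /B !mul_diag_mx mxE braketE mulr_sumr.
  by apply: eq_bigr => k _; rewrite !mxE rmorphM /=; ring.
(* The squared moduli of the entries of [u] sum to 1, so the constant also becomes a weighted
   average and the comparison is termwise. *)
rewrite -[leLHS]mul1r -u1 braketE mulr_suml rmorph_sum -big_split /=.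
apply: ler_sum => i _; rewrite !rmorphM /= conjCK [u i 0 * _]mulrC -mulrDr.
apply: ler_wpM2l; first by rewrite mulrC mul_conjC_ge0.
by rewrite braketC addrC -[X in _ + X]braketC complex_addC lecR lerMn2r fg.
Qed.

Theorem theorem11 (R : realType) (n : nat) (eps : R) (M : 'M[R[i]]_#|cube n|) :
  (1 <= n)%N -> 0 <= eps <= 1 -> gram M ->
  (xpoly eps M <= query_complexity eps M)%E.
Proof.
move=> _ _ _; apply: le_ereal_inf_tmp => _ [T [d [m [a [Mm gen]]]] <-].
have [[m1 mE] [d' [z [J [z1 Ju Ju' fid]]]]] := (Mm, gen).
pose f x := J *m qa_final a x.
(* Tensoring with the unit vector [z] preserves overlaps, and puts the targets in the same space as
   the final states. *)
have ME : M = vectors_mx (fun x => m x *t z) *m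
              (vectors_mx (fun x => m x *t z))^t*.
  apply/matrixP => i j; rewrite vectors_gramE braket_tens z1 mulr1 -mE.
  by rewrite !enum_valK.
(* The Gram matrix of the final states is a candidate in the minimum defining [xpoly]. *)
apply: (@le_trans _ _ (xpoly0 (vectors_mx f *m (vectors_mx f)^t*))%:R%:E).
  apply: ereal_inf_lbound; exists (xpoly0 (vectors_mx f *m (vectors_mx f)^t*)) => //.
  exists (vectors_mx f *m (vectors_mx f)^t*) => //; split.
    by rewrite ME; apply: hadamard_fidelity_ge.
  apply: gram_vectors => x; rewrite /unit_vector braket_unitarymx //.
  exact: unit_qa_state.
rewrite lee_fin ler_nat; apply: xpoly0_degree.
exact/degree_le_mulmx/degree_qa_state.
Qed.
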